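(* For every integer $a \ge 1$, we have $$R(3,a) = \left\lfloor \tfrac{3}{4}a^2 + \tfrac{1}{3}a + \tfrac{1}{4} \right\rfloor .$$
   Context: A finite lattice is graded of rank $3$ if every maximal chain (from bottom to top) has exactly four elements; its elements then lie on four levels: the bottom, the atoms (elements covering the bottom), the coatoms (elements covered by the top), and the top. For integers $c, a \ge 1$, $R(c,a)$ denotes the number of unlabeled graded lattices of rank $3$ (that is, the number of isomorphism classes of such lattices) with exactly $c$ coatoms and exactly $a$ atoms. *)

(* Defs.v *)
From mathcomp Require Import all_boot all_order all_algebra.

Set Implicit Arguments.
Unset Strict Implicit.
Unset Printing Implicit Defensive.

Import Order.TTheory.

Section Lattice.
Context {d : Order.disp_t} (L : finTBLatticeType d).
Implicit Types (x y z : L) (C : {set L}).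
Local Open Scope order_scope.

Definition covers y x := (x < y) && [forall z, ~~ ((x < z) && (z < y))].

Definition atoms : {set L} := [set x | covers x \bot].
Definition coatoms : {set L} := [set x | covers \top x].

Definition chain C := [forall x in C, forall y in C, x >=< y].

Definition graded_rank3 := [forall C, maxset chain C ==> (#|C| == 4)].

Definition graded_rank3_with (c a : nat) :=
  [&& graded_rank3, #|coatoms| == c & #|atoms| == a].

End Lattice.

Definition isomorphic d d' (L : finTBLatticeType d) (L' : finTBLatticeType d') :=
  exists2 f : L -> L', bijective f & {mono f : x y / (x <= y)%O}.

(* [R_eq c a N] means "R(c, a) = N": some family indexed by 'I_N contains
   exactly one representative of each isomorphism class.  The lattices
   themselves do not form a finite type, so R is given by its graph; it is
   single-valued by [R_eq_inj].  Displays carry no order-theoretic content. *)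
Definition R_eq (c a N : nat) :=
  exists (d : Order.disp_t) (F : 'I_N -> finTBLatticeType d),
  [/\ forall i, graded_rank3_with (F i) c a,
      forall i j, isomorphic (F i) (F j) -> i = j
    & forall (d' : Order.disp_t) (L : finTBLatticeType d'),
        graded_rank3_with L c a -> exists i, isomorphic L (F i)].

Lemma isomorphic_sym d d' (L : finTBLatticeType d) (L' : finTBLatticeType d') :
  isomorphic L L' -> isomorphic L' L.
Proof.
move=> [f [g fK gK] fM]; exists g; first by exists f.
by move=> x y; rewrite -fM !gK.
Qed.

Lemma isomorphic_trans d1 d2 d3 (L1 : finTBLatticeType d1)
    (L2 : finTBLatticeType d2) (L3 : finTBLatticeType d3) :
  isomorphic L1 L2 -> isomorphic L2 L3 -> isomorphic L1 L3.
Proof.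
move=> [f fB fM] [g gB gM]; exists (g \o f); first exact: bij_comp.
by move=> x y /=; rewrite gM fM.
Qed.

Lemma R_eq_inj c a M N : R_eq c a M -> R_eq c a N -> M = N.
Proof.
suff le m n : R_eq c a m -> R_eq c a n -> m <= n.
  by move=> hM hN; apply/eqP; rewrite eqn_leq !le.
move=> [d [F [FP Fiso _]]] [d' [G [_ _ Gall]]].
have [h hP] := fin_all_exists (fun i => Gall _ (F i) (FP i)).
have h_inj : injective h.
  move=> i j hij; apply: Fiso; apply: isomorphic_trans (hP i) _.
  by rewrite hij; apply: isomorphic_sym.
by rewrite -[m]card_ord -[n]card_ord; apply: leq_card h_inj.
Qed.

(* Main.v *)
Require Import Defs.
From HB Require Import structures.
From mathcomp Require Import all_boot all_order all_algebra.
From mathcomp Require Import perm zify ring lra.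

(* A graded lattice of rank 3 is the same thing as an incidence relation between
   atoms and coatoms in which every atom and every coatom is incident to
   something and two distinct coatoms share at most one atom.  With three
   coatoms such a relation is determined, up to a permutation of the atoms, by
   the number of atoms incident to each set of coatoms.  Up to a permutation of
   the coatoms there are five cases, according to which sets of at least two
   coatoms occur: none (partitions of a into exactly 3 parts), the set of all
   three coatoms (partitions of a - 1 into at most 3 parts), the three pairs
   (partitions of a - 3 into at most 3 parts), one pair, two pairs (in the last
   two cases only two of the three coatoms are interchangeable, and the count is
   the number of x + y + z = a - 2 with y <= z).  The total increases by 9a - 25
   from a - 6 to a, as does the formula. *)

Set Implicit Arguments.
Unset Strict Implicit.
Unset Printing Implicit Defensive.

Import Order.TTheory GRing.Theory Num.Theory.

(** * The lattice of an incidence relation *)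

Inductive levels (A C : Type) := Bot | Atom of A | Coatom of C | Top.
Arguments Bot {A C}.
Arguments Top {A C}.
Arguments Atom {A C}.
Arguments Coatom {A C}.

Section Levels.
Variables A C : finType.

Definition levels_encode (x : levels A C) : option (option (A + C)) :=
  match x with
  | Bot => None
  | Top => Some None
  | Atom i => Some (Some (inl i))
  | Coatom j => Some (Some (inr j))
  end.

Definition levels_decode (x : option (option (A + C))) : levels A C :=
  match x with
  | None => Bot
  | Some None => Top
  | Some (Some (inl i)) => Atom i
  | Some (Some (inr j)) => Coatom j
  end.

Lemma levels_encodeK : cancel levels_encode levels_decode.
Proof. by case. Qed.

HB.instance Definition _ := Finite.copy (levels A C) (can_type levels_encodeK).

Variable r : A -> C -> bool.

Definition levels_le (x y : levels A C) :=
  match x, y with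
  | Bot, _ | _, Top => true
  | Atom i, Atom i' => i == i'
  | Atom i, Coatom j => r i j
  | Coatom j, Coatom j' => j == j'
  | _, _ => false
  end.

Definition levels_meet (x y : levels A C) :=
  match x, y with
  | Bot, _ | _, Bot => Bot
  | Top, z | z, Top => z
  | Atom i, Atom i' => if i == i' then Atom i else Bot
  | Atom i, Coatom j | Coatom j, Atom i => if r i j then Atom i else Bot
  | Coatom j, Coatom j' =>
      if j == j' then Coatom j
      else if [pick i | r i j && r i j'] is Some i then Atom i else Bot
  end.

Definition levels_join (x y : levels A C) :=
  match x, y with
  | Bot, z | z, Bot => z
  | Top, _ | _, Top => Top
  | Atom i, Atom i' =>
      if i == i' then Atom i
      else if [pick j | r i j && r i' j] is Some j then Coatom j else Top
  | Atom i, Coatom j | Coatom j, Atom i => if r i j then Coatom j else Top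
  | Coatom j, Coatom j' => if j == j' then Coatom j else Top
  end.

(** This is the axiom of a partial linear space. Read on coatoms it bounds the common atoms of two
    distinct coatoms, read on atoms it bounds the common coatoms of two distinct atoms; so the
    element chosen by [pick] in the meet and in the join is the only candidate. *)
Definition linear_space :=
  forall i i' j j', r i j -> r i j' -> r i' j -> r i' j' -> i = i' \/ j = j'.

Lemma levels_le_refl : reflexive levels_le.
Proof. by case=> //= ?; rewrite eqxx. Qed.

Lemma levels_le_anti : antisymmetric levels_le.
Proof.
case=> [|i|j|] [|i'|j'|] //=; rewrite ?andbF //.
  by case/andP=> /eqP->.
by case/andP=> /eqP->.
Qed.

Lemma levels_le_trans : transitive levels_le.
Proof.
by case=> [|i|j|] [|i'|j'|] [|i''|j''|] //= => [/eqP->|/eqP->|+ /eqP<-|/eqP->].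
Qed.

Hypothesis r_lin : linear_space.

Lemma neq_eq_eq (T : eqType) (x y z : T) : y != z -> (x == y) && (x == z) = false.
Proof. by move=> yz; case: eqP => // ->; apply: negbTE. Qed.

Lemma eq_implied (T : eqType) (x y : T) (b : bool) :
  (x == y -> b) -> (x == y) = (x == y) && b.
Proof. by case: eqP b => // _ [] // /(_ isT). Qed.

Lemma levels_meetP x y z :
  levels_le x (levels_meet y z) = levels_le x y && levels_le x z.
Proof.
case: x y z => [|i|j|] [|i'|j'|] [|i''|j''|] //=; rewrite ?andbT ?andbF //.
all: try by case: ifP.
- by have [<-|/neq_eq_eq-> //] := eqVneq i' i''; rewrite andbb.
- by case: ifP => E; [apply: eq_implied => /eqP-> | case: eqP => // ->].
- by case: ifP => E;
    rewrite andbC; [apply: eq_implied => /eqP-> | case: eqP => // ->].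
(* The one case that needs linearity: an atom below two distinct coatoms must be the atom picked as
   their meet. *)
- have [<-|ne] := eqVneq; first by rewrite andbb.
  case: pickP => [k /andP[kj kj'] | none] /=; last by rewrite none.
  apply/eqP/andP => [-> // | [ij ij']].
  by case: (r_lin ij ij' kj kj') ne => // ->; rewrite eqxx.
- have [<-|/neq_eq_eq->] := eqVneq j' j''; first by rewrite andbb.
  by case: pickP.
- by case: eqP => // _; case: pickP.
Qed.

Lemma levels_joinP x y z :
  levels_le (levels_join x y) z = levels_le x z && levels_le y z.
Proof.
case: x y z => [|i|j|] [|i'|j'|] [|i''|j''|] //=; rewrite ?andbT ?andbF //.
all: try by case: ifP.
- by case: eqP => // _; case: pickP.
- rewrite ![_ == i'']eq_sym.
  have [<-|/neq_eq_eq->] := eqVneq i i'; first by rewrite andbb.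
  by case: pickP.
(* Dually, a coatom above two distinct atoms must be the coatom picked as their join. *)
- have [<-|ne] := eqVneq; first by rewrite andbb.
  case: pickP => [k /andP[ik ik'] | none] /=; last by rewrite none.
  apply/eqP/andP => [<- // | [ij ij']].
  by case: (r_lin ik ij ik' ij') ne => // ->; rewrite eqxx.
- by case: eqP => // _; case: pickP.
- by case: ifP => E;
    rewrite andbC; [apply: eq_implied => /eqP<- | case: eqP => // <-].
- by case: ifP => E; [apply: eq_implied => /eqP<- | case: eqP => // <-].
- rewrite ![_ == j'']eq_sym.
  by have [<-|/neq_eq_eq->] := eqVneq j j'; rewrite ?andbb.
Qed.

End Levels.

Record incidence (A C : finType) := Incidence {
  incident :> A -> C -> bool;
  incident_linear : linear_space incident
}.

(** The carrier ignores [P], but keeping [P] in the type lets each relation carry its own order on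
    [levels A C], with linearity supplied by the record. *)
Definition incidence_lattice A C (P : incidence A C) := levels A C.

Section IncidenceLattice.
Variables (A C : finType) (P : incidence A C).

HB.instance Definition _ := Finite.on (incidence_lattice P).
HB.instance Definition _ := Order.Le_isPOrder.Build (Order.Disp tt tt)
  (incidence_lattice P) (@levels_le_refl A C P) (@levels_le_anti A C P)
  (@levels_le_trans A C P).
HB.instance Definition _ := Order.POrder_MeetJoin_isLattice.Build (Order.Disp tt tt)
  (incidence_lattice P) (levels_meetP (@incident_linear A C P))
  (levels_joinP (@incident_linear A C P)).

Fact incidence_lattice_le0x (x : incidence_lattice P) :
  (Bot <= x :> incidence_lattice P)%O.
Proof. by []. Qed.

Fact incidence_lattice_lex1 (x : incidence_lattice P) :
  (x <= Top :> incidence_lattice P)%O.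
Proof. by case: x. Qed.

HB.instance Definition _ := Order.hasBottom.Build (Order.Disp tt tt)
  (incidence_lattice P) incidence_lattice_le0x.
HB.instance Definition _ := Order.hasTop.Build (Order.Disp tt tt)
  (incidence_lattice P) incidence_lattice_lex1.

(** Excludes maximal chains of three elements: an atom below no coatom, or a coatom above no atom,
    would lie on one. *)
Definition covering (A C : finType) (r : A -> C -> bool) :=
  (forall i, exists j, r i j) /\ (forall j, exists i, r i j).

Hypotheses (P_cov : covering P) (C_gt0 : 0 < #|C|).

Let L : finTBLatticeType _ := incidence_lattice P.

Definition flag i j : {set L} := [set x in [:: (Bot : L); Atom i; Coatom j; Top]].

Lemma card_flag i j : #|flag i j| = 4.
Proof. by rewrite cardsE; apply/card_uniqP. Qed.

Lemma chain_flag i j : P i j -> chain (flag i j).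
Proof.
move=> ij; apply/'forall_implyP => x xF; apply/'forall_implyP => y yF.
by move: xF yF; rewrite !inE => /or4P[] /eqP-> /or4P[] /eqP->;
  rewrite /Order.comparable /Order.le /= ?eqxx ?ij ?orbT.
Qed.

(** Distinct atoms are incomparable, and so are distinct coatoms, so a chain contains at most one of
    each; a missing one is supplied by [covering]. Maximal chains are therefore flags. *)
Lemma sub_flag (K : {set L}) :
  chain K -> exists i j, P i j /\ K \subset flag i j.
Proof.
case: P_cov => covA covC /'forall_implyP chK.
have cmp x y : x \in K -> y \in K -> levels_le P x y || levels_le P y x.
  by move=> /chK/'forall_implyP/(_ y).
have sub i j : (forall i', (Atom i' : L) \in K -> i' = i) ->
    (forall j', (Coatom j' : L) \in K -> j' = j) -> K \subset flag i j.
  move=> iP jP; apply/subsetP => -[|i'|j'|] xK; rewrite !inE ?eqxx ?orbT //.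
    by rewrite (iP _ xK) eqxx ?orbT.
  by rewrite (jP _ xK) eqxx ?orbT.
have [i iK|noA] := pickP (fun i => (Atom i : L) \in K).
  have iP i' : (Atom i' : L) \in K -> i' = i.
    by move=> /cmp/(_ iK) /= /orP[] /eqP.
  have [j jK|noC] := pickP (fun j => (Coatom j : L) \in K).
    exists i, j; split; first by have := cmp _ _ iK jK; rewrite /= orbF.
    by apply: sub => // j' /cmp/(_ jK) /= /orP[] /eqP.
  by have [j ij] := covA i; exists i, j; split=> //; apply: sub => // j';
    rewrite noC.
(* Without an atom in [K], the coatom is fixed first (any one if [K] has none) and an atom below it
   is chosen afterwards. *)
have [j jP] : exists j, forall j', (Coatom j' : L) \in K -> j' = j.
  have [j jK|noC] := pickP (fun j => (Coatom j : L) \in K).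
    by exists j => j' /cmp/(_ jK) /= /orP[] /eqP.
  by case/card_gt0P: C_gt0 => j _; exists j => j'; rewrite noC.
by have [i ij] := covC j; exists i, j; split=> //; apply: sub => // i';
  rewrite noA.
Qed.

Lemma incidence_graded_rank3 : graded_rank3 L.
Proof.
apply/forallP => K; apply/implyP => /maxsetP[/sub_flag[i [j [ij sK]]] maxK].
by rewrite -(maxK _ (chain_flag ij) sK) card_flag.
Qed.

Lemma incidence_atoms : atoms L = [set Atom i | i : A].
Proof.
apply/setP => x; rewrite inE; apply/idP/imsetP => [|[i _ ->]].
  case: P_cov => _ covC; case: x => [|i|j|] /andP[// _ /forallP H].
  - by exists i.
  - by have [i ij] := covC j; have := H (Atom i); rewrite /Order.lt /= ij.
  - by case/card_gt0P: C_gt0 => j _; have := H (Coatom j).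
apply/andP; split=> //; apply/forallP; case=> [|i'|j|] //.
have [->|/negPf ne] := eqVneq i' i; first by rewrite ltxx andbF.
by rewrite /Order.lt /= ne ?andbF.
Qed.

Lemma incidence_coatoms : coatoms L = [set Coatom j | j : C].
Proof.
apply/setP => x; rewrite inE; apply/idP/imsetP => [|[j _ ->]].
  case: P_cov => covA covC; case: x => [|i|j|] /andP[// _ /forallP H].
  - by case/card_gt0P: C_gt0 => j _; have := H (Coatom j).
  - by have [j ij] := covA i; have := H (Coatom j); rewrite /Order.lt /= ij.
  - by exists j.
apply/andP; split=> //; apply/forallP; case=> [|i|j'|] //;
  rewrite ?ltxx ?andbF //.
have [->|/negPf ne] := eqVneq j j'; first by rewrite ltxx.
by rewrite /Order.lt /= ne ?andbF.
Qed.

Lemma incidence_graded_rank3_with : graded_rank3_with L #|C| #|A|.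
Proof.
rewrite /graded_rank3_with incidence_graded_rank3 incidence_atoms incidence_coatoms.
by rewrite !card_imset ?eqxx // => ? ? [].
Qed.

End IncidenceLattice.

(** * The incidence relation of a graded lattice of rank 3 *)

Section GradedRank3.
Context {d : Order.disp_t} (L : finTBLatticeType d).
Local Open Scope order_scope.
Implicit Types (x y z : L) (K : {set L}).

Lemma chain_seq (s : seq L) : sorted (<%O) s -> chain [set x in s].
Proof.
rewrite lt_sorted_pairwise => ss.
have /allrelP cs : all2rel (>=<%O) s.
  rewrite -pairwise_all2rel; [|exact: comparablexx|by move=> ? ?; exact: comparable_sym].
  by apply: sub_pairwise ss => x y; apply: lt_comparable.
by apply/'forall_implyP => x xs; apply/'forall_implyP => y ys; apply: cs;
  rewrite -?topredE /= -?in_set.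
Qed.

Hypothesis L3 : graded_rank3 L.

Lemma chain_extend K :
  chain K -> exists M : {set L}, [/\ chain M, K \subset M & #|M| = 4].
Proof.
move=> /maxset_exists[M maxM sKM]; exists M; split=> //;
  first exact: maxsetp maxM.
by apply/eqP; move/forallP/(_ M)/implyP: L3; apply.
Qed.

Lemma sorted_size (s : seq L) : sorted (<%O) s -> (size s <= 4)%N.
Proof.
move=> ss; have [M [_ sM <-]] := chain_extend (chain_seq ss).
apply: leq_trans (subset_leq_card sM).
by rewrite cardsE (card_uniqP _) // lt_sorted_uniq.
Qed.

Lemma no_interior_chain3 x y z : \bot < x -> x < y -> y < z -> z < \top -> False.
Proof.
move=> bx xy yz zt.
by have := @sorted_size [:: \bot; x; y; z; \top];
  rewrite /= bx xy yz zt => /(_ isT).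
Qed.

(** The second half of gradedness: [sorted_size] says that no chain is too long, this says that a
    short chain is never maximal. *)
Lemma sorted_refine (s : seq L) : sorted (<%O) s -> (size s < 4)%N ->
  exists2 y, y \notin s & {in s, forall x, x >=< y}.
Proof.
move=> ss szs; have [M [/'forall_implyP chM sM M4]] := chain_extend (chain_seq ss).
have : (0 < #|M :\: [set x in s]|)%N.
  rewrite cardsD (setIidPr sM) M4 subn_gt0; apply: leq_ltn_trans szs.
  by rewrite cardsE card_size.
case/card_gt0P => y; rewrite !inE => /andP[ys yM]; exists y => // x xs.
have xM : x \in M by apply: (subsetP sM); rewrite inE.
by have /'forall_implyP/(_ y yM) := chM x xM.
Qed.

Lemma interior_neighbour x : \bot < x -> x < \top ->
  exists y, [/\ \bot < y, y < \top & (x < y) || (y < x)].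
Proof.
move=> bx xt; have [|//|y] := @sorted_refine [:: \bot; x; \top];
  first by rewrite /= bx xt.
rewrite !inE !negb_or -lt0x -ltx1 => /and3P[by' yx yt] cmp;
  exists y; split=> //.
have := cmp x; rewrite !inE eqxx orbT => /(_ isT).
by rewrite /Order.comparable !le_eqVlt eq_sym (negPf yx).
Qed.

(** Replaces the minimality in the definition of an atom by a witness above it. An element with such
    a witness covers the bottom, as otherwise three interior elements would form a chain. *)
Lemma atomP x : reflect (\bot < x /\ exists2 y, x < y & y < \top) (x \in atoms L).
Proof.
rewrite inE; apply: (iffP andP) => [[bx /forallP xmin]|[bx [y xy yt]]];
  last first.
  split=> //; apply/forallP => z; apply/negP => /andP[bz zx].
  exact: no_interior_chain3 bz zx xy yt.
(* The top cannot cover the bottom, since the chain of these two elements can be refined. *)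
split=> //; have [xt|xt] := eqVneq x \top.
  have [|//|y] := @sorted_refine [:: \bot; x]; first by rewrite /= bx.
  rewrite !inE negb_or -lt0x xt -ltx1 => /andP[by' yt] _.
  by have := xmin y; rewrite by' xt yt.
have [|y [by' yt /orP[xy|yx]]] := interior_neighbour bx; rewrite ?ltx1 //;
  first by exists y.
by have := xmin y; rewrite by' yx.
Qed.

Lemma coatomP x : reflect (x < \top /\ exists2 y, \bot < y & y < x) (x \in coatoms L).
Proof.
rewrite inE; apply: (iffP andP) => [[xt /forallP xmax]|[xt [y by' yx]]];
  last first.
  split=> //; apply/forallP => z; apply/negP => /andP[xz zt].
  exact: no_interior_chain3 by' yx xz zt.
split=> //; have [xb|xb] := eqVneq x \bot.
  have [|//|y] := @sorted_refine [:: x; \top]; first by rewrite /= xt.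
  rewrite !inE negb_or xb -lt0x -ltx1 => /andP[by' yt] _.
  by have := xmax y; rewrite xb by' yt.
have [|y [by' yt /orP[xy|yx]]] := interior_neighbour _ xt; rewrite ?lt0x //;
  last by exists y.
by have := xmax y; rewrite xy yt.
Qed.

Lemma atom_neq_coatom x : x \in atoms L -> x \in coatoms L -> False.
Proof.
case/atomP=> _ [z xz zt] /coatomP[_ [y by' yx]].
exact: no_interior_chain3 by' yx xz zt.
Qed.

Lemma interior_atom_or_coatom x :
  \bot < x -> x < \top -> (x \in atoms L) || (x \in coatoms L).
Proof.
move=> bx xt; have [y [by' yt /orP[xy|yx]]] := interior_neighbour bx xt;
  apply/orP.
  by left; apply/atomP; split=> //; exists y.
by right; apply/coatomP; split=> //; exists y.
Qed.

Lemma atom_le x y : x \in atoms L -> y \in atoms L -> (x <= y) = (x == y).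
Proof.
case/atomP=> bx _; rewrite inE => /andP[by' /forallP/(_ x)].
by rewrite bx /= le_eqVlt => /negPf->; rewrite orbF.
Qed.

Lemma coatom_le x y : x \in coatoms L -> y \in coatoms L -> (x <= y) = (x == y).
Proof.
move=> + /coatomP[yt _]; rewrite inE => /andP[xt /forallP/(_ y)].
by rewrite yt andbT le_eqVlt => /negPf->; rewrite orbF.
Qed.

Lemma coatom_le_atom x y : x \in coatoms L -> y \in atoms L -> (x <= y) = false.
Proof.
move=> xC yA; apply/negbTE/negP; rewrite le_eqVlt => /orP[/eqP xy|xy].
  by apply: (@atom_neq_coatom x) => //; rewrite xy.
case/coatomP: xC => _ [z bz zx]; case/atomP: yA => _ [t yt tT].
exact: no_interior_chain3 bz zx xy (lt_trans yt tT).
Qed.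

Variables (A C : finType) (alpha : A -> L) (gamma : C -> L).
Hypotheses (alpha_inj : injective alpha) (gamma_inj : injective gamma).
Hypotheses (alphaE : atoms L = [set alpha i | i : A]).
Hypotheses (gammaE : coatoms L = [set gamma j | j : C]).

Let alphaA i : alpha i \in atoms L. Proof. by rewrite alphaE imset_f. Qed.
Let gammaC j : gamma j \in coatoms L. Proof. by rewrite gammaE imset_f. Qed.

Definition lattice_incidence (i : A) (j : C) := alpha i <= gamma j.

Definition of_levels (x : levels A C) : L :=
  match x with Bot => \bot | Atom i => alpha i | Coatom j => gamma j | Top => \top end.

Lemma lattice_incidence_linear : linear_space lattice_incidence.
Proof.
move=> i i' j j' ij ij' i'j i'j'.
have [|ne] := eqVneq i i'; first by left.
right; apply/eqP/negPn/negP => ne'.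
(* For distinct atoms below two distinct coatoms, the join lies strictly between an atom and a
   coatom, which gives three interior elements in a chain. *)
pose u := alpha i `|` alpha i'.
have bi : \bot < alpha i by case/atomP: (alphaA i).
have jt : gamma j < \top by case/coatomP: (gammaC j).
apply: (@no_interior_chain3 (alpha i) u (gamma j)) => //.
  rewrite lt_neqAle leUl andbT; apply/negP => /eqP E; case/negP: ne.
  by rewrite eq_sym -(inj_eq alpha_inj) -atom_le // E leUr.
rewrite lt_neqAle leUx (ij : _ <= _) (i'j : _ <= _) !andbT;
  apply/negP => /eqP E; case/negP: ne'.
by rewrite -(inj_eq gamma_inj) -coatom_le // -E leUx; apply/andP.
Qed.

Lemma lattice_incidence_covering : covering lattice_incidence.
Proof.
split=> [i|j].
  have /atomP[bi [y iy yt]] := alphaA i.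
  have : y \in coatoms L by apply/coatomP; split=> //; exists (alpha i).
  by rewrite gammaE => /imsetP[j _ yj]; exists j;
    rewrite /lattice_incidence -yj ltW.
have /coatomP[jt [y by' yj]] := gammaC j.
have : y \in atoms L by apply/atomP; split=> //; exists (gamma j).
by rewrite alphaE => /imsetP[i _ yi]; exists i;
  rewrite /lattice_incidence -yi ltW.
Qed.

Hypothesis C_gt0 : (0 < #|C|)%N.

Lemma of_levels_le :
  {mono of_levels : x y / levels_le lattice_incidence x y >-> x <= y}.
Proof.
have bi i : \bot < alpha i by case/atomP: (alphaA i).
have it i : alpha i < \top by case/atomP: (alphaA i) => _ [y] /lt_trans; apply.
have bj j : \bot < gamma j by case/coatomP: (gammaC j) => _ [y] /lt_trans;
  apply.
have jt j : gamma j < \top by case/coatomP: (gammaC j).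
have bt : \bot < \top :> L by case/card_gt0P: C_gt0 => j _;
  apply: lt_trans (jt j).
case=> [|i|j|] [|i'|j'|] /=; rewrite ?le0x ?lex1 //;
  rewrite ?(lt_geF (bi _)) ?(lt_geF (it _)) ?(lt_geF (bj _)) ?(lt_geF (jt _)) ?(lt_geF bt) //.
- by rewrite atom_le // (inj_eq alpha_inj).
- by rewrite coatom_le_atom.
- by rewrite coatom_le // (inj_eq gamma_inj).
Qed.

(** Injectivity follows from reflecting the order; surjectivity holds because an interior element is
    an atom or a coatom. *)
Lemma of_levels_bij : bijective of_levels.
Proof.
have inj : injective of_levels.
  by move=> x y E; apply: (@levels_le_anti _ _ lattice_incidence);
    rewrite -!of_levels_le E lexx.
apply: inj_card_bij => //.
suff sub : {subset predT <= codom of_levels}.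
  by rewrite -(card_codom inj); apply/subset_leq_card/subsetP.
move=> x _; have [->|xb] := eqVneq x \bot; first exact: (codom_f of_levels Bot).
have [->|xt] := eqVneq x \top; first exact: (codom_f of_levels Top).
have /orP[] : (x \in atoms L) || (x \in coatoms L).
- by apply: interior_atom_or_coatom; rewrite ?lt0x ?ltx1.
- by rewrite alphaE => /imsetP[i _ ->]; exact: (codom_f of_levels (Atom i)).
- by rewrite gammaE => /imsetP[j _ ->]; exact: (codom_f of_levels (Coatom j)).
Qed.

End GradedRank3.

(** * Lattice isomorphisms and isomorphisms of incidence relations *)

Definition presents (A C : finType) (r : A -> C -> bool)
    d (L : finTBLatticeType d) :=
  exists2 phi : levels A C -> L, bijective phi &
    {mono phi : x y / levels_le r x y >-> (x <= y)%O}.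

Definition incidence_iso (A C A' C' : finType)
    (r : A -> C -> bool) (r' : A' -> C' -> bool) :=
  exists f : A -> A', exists g : C -> C',
    [/\ bijective f, bijective g & forall i j, r' (f i) (g j) = r i j].

Lemma incidence_lattice_presents (A C : finType) (P : incidence A C) :
  presents P (incidence_lattice P).
Proof. by exists id => //; exists id. Qed.

Lemma presents_isomorphic (A C A' C' : finType) (r : A -> C -> bool)
    (r' : A' -> C' -> bool)
    d (L : finTBLatticeType d) d' (L' : finTBLatticeType d') :
  presents r L -> presents r' L' -> incidence_iso r r' -> isomorphic L L'.
Proof.
move=> [phi [phi' phiK phi'K] phi_le] [psi psi_bij psi_le] [f [g [f_bij g_bij fg]]].
pose h (x : levels A C) : levels A' C' :=
  match x with Bot => Bot | Atom i => Atom (f i) | Coatom j => Coatom (g j) | Top => Top end.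
have h_bij : bijective h.
  case: f_bij g_bij => f' fK f'K [g' gK g'K].
  exists (fun x : levels A' C' => match x with
    Bot => Bot | Atom i => Atom (f' i) | Coatom j => Coatom (g' j) | Top => Top end).
  - by case=> //= ?; rewrite ?fK ?gK.
  - by case=> //= ?; rewrite ?f'K ?g'K.
have h_le : {mono h : x y / levels_le r x y >-> levels_le r' x y}.
  by case=> [|i|j|] [|i'|j'|] //=; rewrite ?(bij_eq f_bij) ?(bij_eq g_bij).
exists (psi \o h \o phi').
  by apply: bij_comp; [exact: bij_comp | exists phi].
by move=> x y /=; rewrite psi_le h_le -phi_le !phi'K.
Qed.

Section LevelsIso.
Variables (A C A' C' : finType) (r : A -> C -> bool) (r' : A' -> C' -> bool).
Hypotheses (r_cov : covering r).
Variable h : levels A C -> levels A' C'.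
Hypotheses (h_bij : bijective h).
Hypothesis (h_le : {mono h : x y / levels_le r x y >-> levels_le r' x y}).

Let h_inj : injective h := bij_inj h_bij.

Lemma levels_iso_Bot : h Bot = Bot.
Proof.
case: h_bij => h' _ h'K; apply: (@levels_le_anti _ _ r').
by rewrite andbT -[Bot in X in levels_le _ _ X]h'K h_le.
Qed.

Lemma levels_iso_Top : h Top = Top.
Proof.
case: h_bij => h' _ h'K; apply: (@levels_le_anti _ _ r').
by rewrite -[Top in X in _ && X]h'K h_le; case: (h Top); case: (h' Top).
Qed.

(** The images of an atom and of a coatom above it are distinct, comparable and neither bottom nor
    top, so the lower one is an atom. *)
Lemma levels_iso_Atom i : exists i', h (Atom i) = Atom i'.
Proof.
have [j ij] := r_cov.1 i.
have lij : levels_le r' (h (Atom i)) (h (Coatom j)) by rewrite h_le.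
case E: (h (Atom i)) lij => [|i'|k|].
- by move: E; rewrite -levels_iso_Bot => /h_inj.
- by exists i'.
- case F: (h (Coatom j)) => [|i'|k'|] //=.
    by move/eqP=> kk'; move: E; rewrite kk' -F => /h_inj.
  by move: F; rewrite -levels_iso_Top => /h_inj.
- by move: E; rewrite -levels_iso_Top => /h_inj.
Qed.

Lemma levels_iso_Coatom j : exists j', h (Coatom j) = Coatom j'.
Proof.
have [i ij] := r_cov.2 j.
have lij : levels_le r' (h (Atom i)) (h (Coatom j)) by rewrite h_le.
case E: (h (Coatom j)) lij => [|k|j'|].
- by move: E; rewrite -levels_iso_Bot => /h_inj.
- case F: (h (Atom i)) => [|k'|j'|] //=.
    by move: F; rewrite -levels_iso_Bot => /h_inj.
  by move/eqP=> kk'; move: E; rewrite -kk' -F => /h_inj.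
- by exists j'.
- by move: E; rewrite -levels_iso_Top => /h_inj.
Qed.

End LevelsIso.

Lemma isomorphic_incidence_iso (A C A' C' : finType) (r : A -> C -> bool)
    (r' : A' -> C' -> bool)
    d (L : finTBLatticeType d) d' (L' : finTBLatticeType d') :
  covering r -> covering r' ->
  presents r L -> presents r' L' -> isomorphic L L' -> incidence_iso r r'.
Proof.
move=> cov cov' [phi phi_bij phi_le] [psi psi_bij psi_le] [k k_bij k_le].
have [psi' psiK psi'K] := psi_bij.
pose h := psi' \o k \o phi.
have h_bij : bijective h by apply: bij_comp => //; apply: bij_comp => //;
  exists psi.
have h_le : {mono h : x y / levels_le r x y >-> levels_le r' x y}.
  by move=> x y; rewrite -psi_le /h /= !psi'K k_le phi_le.
have [h' hK h'K] := h_bij.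
have h'_bij : bijective h' by exists h.
have h'_le : {mono h' : x y / levels_le r' x y >-> levels_le r x y}.
  by move=> x y; rewrite -h_le !h'K.
(* The restrictions of [h] to the two middle levels give [f] and [g]; those of its inverse show that
   they are bijective. *)
have [f fP] := fin_all_exists (levels_iso_Atom cov h_bij h_le).
have [g gP] := fin_all_exists (levels_iso_Coatom cov h_bij h_le).
have [f' f'P] := fin_all_exists (levels_iso_Atom cov' h'_bij h'_le).
have [g' g'P] := fin_all_exists (levels_iso_Coatom cov' h'_bij h'_le).
exists f, g; split.
- exists f' => i; first by have := hK (Atom i); rewrite fP f'P => -[].
  by have := h'K (Atom i); rewrite f'P fP => -[].
- exists g' => j; first by have := hK (Coatom j); rewrite gP g'P => -[].
  by have := h'K (Coatom j); rewrite g'P gP => -[].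
by move=> i j; have := h_le (Atom i) (Coatom j); rewrite fP gP.
Qed.

Lemma graded_presentation (c a : nat) d (L : finTBLatticeType d) :
  0 < c -> graded_rank3_with L c a ->
  exists r : 'I_a -> 'I_c -> bool, [/\ linear_space r, covering r & presents r L].
Proof.
move=> c_gt0 /and3P[L3 /eqP cE /eqP aE].
pose alpha (i : 'I_a) : L := enum_val (cast_ord (esym aE) i).
pose gamma (j : 'I_c) : L := enum_val (cast_ord (esym cE) j).
have alpha_inj : injective alpha by move=> i j /enum_val_inj/cast_ord_inj.
have gamma_inj : injective gamma by move=> i j /enum_val_inj/cast_ord_inj.
have alphaE : atoms L = [set alpha i | i : 'I_a].
  apply/esym/eqP; rewrite eqEcard card_imset // card_ord aE leqnn andbT.
  by apply/subsetP => _ /imsetP[i _ ->]; apply: enum_valP.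
have gammaE : coatoms L = [set gamma j | j : 'I_c].
  apply/esym/eqP; rewrite eqEcard card_imset // card_ord cE leqnn andbT.
  by apply/subsetP => _ /imsetP[i _ ->]; apply: enum_valP.
exists (lattice_incidence alpha gamma); split.
- exact: lattice_incidence_linear.
- exact: lattice_incidence_covering.
exists (of_levels alpha gamma).
  by apply: of_levels_bij => //; rewrite card_ord.
by apply: of_levels_le => //; rewrite card_ord.
Qed.

(** * Three coatoms: counting atoms by their sets of coatoms *)

Lemma R_eq_incidence (c a N : nat) (F : 'I_N -> 'I_a -> 'I_c -> bool) :
  0 < c ->
  (forall i, linear_space (F i)) -> (forall i, covering (F i)) ->
  (forall i j, incidence_iso (F i) (F j) -> i = j) ->
  (forall r : 'I_a -> 'I_c -> bool, linear_space r -> covering r ->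
     exists i, incidence_iso r (F i)) ->
  R_eq c a N.
Proof.
move=> c_gt0 lin cov F_inj F_surj; pose P i := Incidence (lin i).
exists _, (fun i => incidence_lattice (P i) : finTBLatticeType _); split.
- move=> i; have := @incidence_graded_rank3_with _ _ (P i) (cov i).
  by rewrite !card_ord; apply.
- move=> i j iso; apply: F_inj.
  exact: isomorphic_incidence_iso (cov i) (cov j)
    (incidence_lattice_presents (P i)) (incidence_lattice_presents (P j)) iso.
move=> d' L /(graded_presentation c_gt0)[r [r_lin r_cov r_pres]].
have [i iso] := F_surj r r_lin r_cov; exists i.
exact: presents_isomorphic r_pres (incidence_lattice_presents (P i)) iso.
Qed.

(** * Functions with prescribed fiber sizes *)

Section Fibers.
Variables (T : finType) (n : nat).
Implicit Types t : 'I_n -> T.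

Lemma count_codom t b : count_mem b (codom t) = #|[pred i | t i == b]|.
Proof. by rewrite count_map cardE size_filter -enumT; apply: eq_count => i;
  rewrite inE. Qed.

(** Equal fiber sizes mean equal multisets of values, so the two value lists are permutations of
    each other. *)
Lemma eq_fibers_perm t t' :
  (forall b, #|[pred i | t i == b]| = #|[pred i | t' i == b]|) ->
  exists f : 'I_n -> 'I_n, bijective f /\ forall i, t' (f i) = t i.
Proof.
move=> tt'; have mktupleE u : [tuple u i | i < n] = codom u :> seq T by [].

have /tuple_permP[p pE] : perm_eq [tuple t i | i < n] [tuple t' i | i < n].
  by rewrite !mktupleE; apply/allP => b _ /=; rewrite !count_codom tt'.
exists p; split=> [|i]; first exact: injF_bij perm_inj.
by rewrite -(tnth_mktuple t i) (val_inj pE : [tuple t i | i < n] = _) !tnth_mktuple.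
Qed.

Lemma fibers_exist (v : T -> nat) : \sum_b v b = n ->
  exists t, forall b, #|[pred i | t i == b]| = v b.
Proof.
(* The function is read off the list that repeats each value [b] exactly [v b] times. *)
move=> vn; pose s := flatten [seq nseq (v b) b | b <- enum T].
have size_s : size s == n.
  rewrite size_flatten /shape -map_comp sumnE big_map big_enum /= -[X in _ == X]vn.
  by apply/eqP/eq_bigr => b _; rewrite size_nseq.
exists (tnth (Tuple size_s)) => b; rewrite -count_codom.
rewrite codomE map_tnth_enum /= count_flatten -map_comp sumnE big_map big_enum /=.
rewrite (bigD1 b) //= count_nseq /= eqxx mul1n big1 ?addn0 // => b' nb.
by rewrite count_nseq /= (negPf nb).
Qed.

Lemma card_fibers t (Q : pred T) :
  #|[pred i | Q (t i)]| = \sum_(b | Q b) #|[pred i | t i == b]|.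
Proof.
rewrite -sum1_card (partition_big t Q) //=; apply: eq_bigr => b Qb.
by rewrite -sum1_card; apply: eq_bigl => i; rewrite !inE; case: eqP => [->|];
  rewrite ?Qb ?andbF.
Qed.

End Fibers.

Definition triple : finType := (bool * bool * bool)%type.

Lemma sum_triple (v : triple -> nat) :
  \sum_b v b = v (true, true, true) + v (true, true, false)
    + v (true, false, true) + v (true, false, false)
    + v (false, true, true) + v (false, true, false)
    + v (false, false, true) + v (false, false, false).
Proof.
rewrite (eq_bigr (fun b => v (b.1.1, b.1.2, b.2))); last by case=> [[]].
rewrite -(pair_bigA _ (fun x y => v (x.1, x.2, y))) /=.
rewrite -(pair_bigA _ (fun x y => \sum_z v (x, y, z))) /=.
by rewrite !big_bool /= !addnA.
Qed.

Notation o0 := (@Ordinal 3 0 isT).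
Notation o1 := (@Ordinal 3 1 isT).
Notation o2 := (@Ordinal 3 2 isT).

Lemma ord3_ind (P : 'I_3 -> Prop) : P o0 -> P o1 -> P o2 -> forall i, P i.
Proof.
by move=> P0 P1 P2 [[|[|[|//]]] lt]; rewrite (bool_irrelevance lt isT).
Qed.

Definition component (b : triple) (j : 'I_3) := nth false [:: b.1.1; b.1.2; b.2] j.

Definition rearrange (p q s : 'I_3) (b : triple) : triple :=
  (component b p, component b q, component b s).

Lemma rearrange_inj p q s : uniq [:: p; q; s] -> injective (rearrange p q s).
Proof.
move=> u [[b1 b2] b3] [[c1 c2] c3]; rewrite /rearrange /component /=.
by elim/ord3_ind: p u; elim/ord3_ind: q; elim/ord3_ind: s => //= _ [-> -> ->].
Qed.

Section Profile.
Variable a : nat.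
Implicit Types (r : 'I_a -> 'I_3 -> bool) (p q s : 'I_3).

Definition coatoms_above r p q s (i : 'I_a) : triple := (r i p, r i q, r i s).

(** The order in which the coatoms are read is an argument, so that relabelling them means changing
    [p], [q], [s] while [r] stays fixed. *)
Definition profile r p q s (b : triple) :=
  #|[pred i | coatoms_above r p q s i == b]|.

Lemma profile_rearrange r p q s b : uniq [:: p; q; s] ->
  profile r p q s (rearrange p q s b) = profile r o0 o1 o2 b.
Proof.
move=> /rearrange_inj inj; apply: eq_card => i; rewrite !inE -[RHS](inj_eq inj).
suff E j : component (coatoms_above r o0 o1 o2 i) j = r i j by rewrite /rearrange !E.
by elim/ord3_ind: j.
Qed.

Lemma sum_profile r p q s : \sum_b profile r p q s b = a.
Proof. by rewrite -(card_fibers _ predT) card_ord. Qed.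

Lemma profile_iso r r' p q s (f : 'I_a -> 'I_a) (g : 'I_3 -> 'I_3) :
  bijective f -> (forall i j, r' (f i) (g j) = r i j) ->
  profile r' (g p) (g q) (g s) =1 profile r p q s.
Proof.
move=> f_bij fg b; rewrite /profile -!sum1_card [LHS](reindex f) /=;
  last exact: onW_bij.
by apply: eq_bigl => i; rewrite !inE /coatoms_above !fg.
Qed.

Lemma profile_eq_iso r r' p q s p' q' s' :
  uniq [:: p; q; s] -> uniq [:: p'; q'; s'] ->
  profile r p q s =1 profile r' p' q' s' -> incidence_iso r r'.
Proof.
move=> u u' /eq_fibers_perm[f [f_bij ff]].
have bij (x y z : 'I_3) : uniq [:: x; y; z] -> bijective (tnth [tuple x; y; z]).
  by move=> uxyz; apply: injF_bij; apply/tuple_uniqP.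
(* [t] gives the position of a coatom in [p, q, s]; the coatom bijection sends it to the entry of
   [p', q', s'] at that position. *)
have [t tK Kt] := bij _ _ _ u; have bij' := bij _ _ _ u'.
exists f, (tnth [tuple p'; q'; s'] \o t); split=> //.
  by apply: bij_comp => //; exists (tnth [tuple p; q; s]).
move=> i j; rewrite -[in RHS](Kt j) /=; have [e1 e2 e3] := ff i.
by elim/ord3_ind: (t j); rewrite !(tnth_nth p) /=.
Qed.

Definition valid_profile (v : triple -> nat) :=
  [/\ v (false, false, false) = 0,
      [/\ v (true, true, true) + v (true, true, false) <= 1,
          v (true, true, true) + v (true, false, true) <= 1
        & v (true, true, true) + v (false, true, true) <= 1]
    & [/\ 0 < v (true, true, true) + v (true, true, false)
              + v (true, false, true) + v (true, false, false),
          0 < v (true, true, true) + v (true, true, false)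
              + v (false, true, true) + v (false, true, false)
        & 0 < v (true, true, true) + v (true, false, true)
              + v (false, true, true) + v (false, false, true)]].

Lemma valid_profileP r :
  linear_space r /\ covering r <-> valid_profile (profile r o0 o1 o2).
Proof.
(* Each sum in [valid_profile] is the cardinal of a set of atoms, so the conditions become
   emptiness, having at most one element, or inhabitedness. *)
have card Q := card_fibers (coatoms_above r o0 o1 o2) Q.
have := (card (fun b => b.1.1 && b.1.2), card (fun b => b.1.1 && b.2),
  card (fun b => b.1.2 && b.2), card (fun b => b.1.1), card (fun b => b.1.2),
  card (fun b => b.2), card (fun b => ~~ b.1.1 && ~~ b.1.2 && ~~ b.2)).
rewrite ![\sum_(b | _) _]big_mkcond !sum_triple /= !addn0 !add0n.
move=> [[[[[[E01 E02] E12] E0] E1] E2] En].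
rewrite /valid_profile /profile -E0 -E1 -E2 -E01 -E02 -E12 -En; split.
  move=> [lin [covA covC]]; split.
  - apply: eq_card0 => i; rewrite !inE; have [j] := covA i.
    by elim/ord3_ind: j => ->; rewrite ?andbF.
  - split; apply/card_le1_eqP => i i' /andP[ij ij'] /andP[i'j i'j'] /=;
      by case: (lin _ _ _ _ ij ij' i'j i'j').
  - split; apply/card_gt0P.
    + by have [i] := covC o0; exists i.
    + by have [i] := covC o1; exists i.
    + by have [i] := covC o2; exists i.
move=> [/card0_eq none [le01 le02 le12] [gt0 gt1 gt2]]; split; last split.
- move=> i i' j j' ij ij' i'j i'j'.
  have [|jj'] := eqVneq j j'; [by right | left].
  move: jj' ij ij' i'j i'j'.
  by elim/ord3_ind: j; elim/ord3_ind: j' => //= _ ij ij' i'j i'j';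
    [move/card_le1_eqP: le01 | move/card_le1_eqP: le02 | move/card_le1_eqP: le01
    | move/card_le1_eqP: le12 | move/card_le1_eqP: le02 | move/card_le1_eqP: le12];
    apply; rewrite inE; apply/andP.
- move=> i; have := none i; rewrite !inE.
  case r0: (r i o0); first by exists o0.
  case r1: (r i o1); first by exists o1.
  by case r2: (r i o2); first exists o2.
- by elim/ord3_ind; [have [i] := card_gt0P gt0 | have [i] := card_gt0P gt1 | have [i] := card_gt0P gt2];
    exists i.
Qed.

Lemma profile_exists (v : triple -> nat) : \sum_b v b = a ->
  exists r, profile r o0 o1 o2 =1 v.
Proof.
move=> /fibers_exist[t tP]; exists (fun i => component (t i)) => b.
by rewrite -tP; apply: eq_card => i; rewrite !inE /coatoms_above /component /=;
  case: (t i) => [[]].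
Qed.

End Profile.

(* The four bits tell whether there is an atom whose set of coatoms is {1,2},
   {1,3}, {2,3}, {1,2,3} (each occurs at most once); the three numbers count the
   atoms below the coatom 1, 2, 3 only. *)
Definition code : eqType := ((bool * bool * bool * bool) * (nat * nat * nat))%type.

Definition code_profile (c : code) (b : triple) : nat :=
  let: (e12, e13, e23, e123, (x, y, z)) := c in
  match b with
  | (true, true, true) => e123
  | (true, true, false) => e12
  | (true, false, true) => e13
  | (false, true, true) => e23
  | (true, false, false) => x
  | (false, true, false) => y
  | (false, false, true) => z
  | (false, false, false) => 0
  end.

(** The shared pairs are placed so that coatoms 2 and 3 stay interchangeable, which [y <= z] breaks;
    the fully symmetric patterns sort all three counts. Positivity of [x] is imposed where coatom 1
    would otherwise lie above no atom. *)
Definition canonical (c : code) : bool :=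
  let: (e, (x, y, z)) := c in
  match e with
  | (false, false, false, false) => (0 < x) && (x <= y <= z)
  | (false, false, false, true) | (true, true, true, false) => x <= y <= z
  | (false, false, true, false) => (0 < x) && (y <= z)
  | (true, true, false, false) => y <= z
  | _ => false
  end.

Lemma canonical_valid c : canonical c -> valid_profile (code_profile c).
Proof.
by case: c => [[[[[] []] []] []] [[x y] z]] //= H; split=> //=; split; lia.
Qed.

Lemma canonical_unique c c' p q s : uniq [:: p; q; s] ->
  canonical c -> canonical c' ->
  (forall b, code_profile c (rearrange p q s b) = code_profile c' b) -> c = c'.
Proof.
move=> u can can' E; rewrite /rearrange /component in E.
have /= := (E (true, false, false), E (false, true, false), E (false, false, true),
  E (true, true, false), E (true, false, true), E (false, true, true), E (true, true, true)).
move: {E} u can can'.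
(* For each of the six orderings and each pair of patterns, either the hypotheses clash or linear
   arithmetic on the counts remains. *)
elim/ord3_ind: p; elim/ord3_ind: q; elim/ord3_ind: s => // _.
all: case: c => [[[[[] []] []] []] [[x y] z]] //=.
all: case: c' => [[[[[] []] []] []] [[x' y'] z']] //=.
all: move=> can can' [[[[[[]]]]]] //; intros; congr (_, (_, _, _)); lia.
Qed.

(** Encodes the set of coatoms [p] and [q]; taking [p = q] gives a singleton, as [code_in] does. *)
Definition only_above (p q : 'I_3) : triple :=
  ((p == 0 :> nat) || (q == 0 :> nat), (p == 1 :> nat) || (q == 1 :> nat),
   (p == 2 :> nat) || (q == 2 :> nat)).

Definition code_in (v : triple -> nat) (p q s : 'I_3) : code :=
  (0 < v (only_above p q), 0 < v (only_above p s), 0 < v (only_above q s),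
   0 < v (true, true, true),
   (v (only_above p p), v (only_above q q), v (only_above s s))).

(** Recording only positivity of the shared counts loses nothing, since validity bounds them by
    1. *)
Lemma code_inK v p q s : valid_profile v -> uniq [:: p; q; s] ->
  forall b, v b = code_profile (code_in v p q s) (rearrange p q s b).
Proof.
move=> [v0 [v12 v13 v23] _] u b; have bit n : n <= 1 -> n = (0 < n) by lia.
rewrite /code_in /rearrange /component /only_above.
by elim/ord3_ind: p u; elim/ord3_ind: q; elim/ord3_ind: s => //= _;
  case: b => [[[] []] []] //=; apply: bit; lia.
Qed.

Lemma canonical_exists v : valid_profile v ->
  exists p q s, uniq [:: p; q; s] /\ canonical (code_in v p q s).
Proof.
move=> [v0 [v12 v13 v23] [v1 v2 v3]].
(* As a Boolean disjunction over the six orderings, the claim is linear arithmetic once it is known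
   which of the four shared counts vanish. *)
suff : [|| canonical (code_in v o0 o1 o2), canonical (code_in v o0 o2 o1),
    canonical (code_in v o1 o0 o2), canonical (code_in v o1 o2 o0),
    canonical (code_in v o2 o0 o1) | canonical (code_in v o2 o1 o0)].
  by case/or4P=> [can|can|can|/or3P[]can];
    [exists o0, o1, o2 | exists o0, o2, o1 | exists o1, o0, o2
    | exists o1, o2, o0 | exists o2, o0, o1 | exists o2, o1, o0].
rewrite /code_in /only_above /eq_op /=.
case: (posnP (v (true, true, false))) => E12;
  case: (posnP (v (true, false, true))) => E13;
case: (posnP (v (false, true, true))) => E23;
  case: (posnP (v (true, true, true))) => E123.
all: cbv match; lia.
Qed.

(** * Enumeration of the canonical codes *)

Definition atom_count (c : code) : nat :=
  let: (e12, e13, e23, e123, (x, y, z)) := c in e12 + e13 + e23 + e123 + (x + y + z).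

Lemma sum_code_profile c : \sum_b code_profile c b = atom_count c.
Proof. by case: c => [[[[e12 e13] e23] e123] [[x y] z]]; rewrite sum_triple /=;
  lia. Qed.

(** Recursion on the smallest entry: either it is 0, and [y] runs from 0 to half of [n], or 1 can be
    removed from all three entries. *)
Fixpoint sorted_triples (n : nat) : seq (nat * nat * nat) :=
  [seq (0, y, n - y) | y <- iota 0 n./2.+1] ++
  if n is m.+3 then [seq (s.1.1.+1, s.1.2.+1, s.2.+1) | s <- sorted_triples m] else [::].

(** Here only [y] and [z] are ordered, so 1 is removed from these two until [y] is 0. *)
Fixpoint semisorted_triples (n : nat) : seq (nat * nat * nat) :=
  [seq (x, 0, n - x) | x <- iota 0 n.+1] ++
  if n is m.+2 then [seq (s.1.1, s.1.2.+1, s.2.+1) | s <- semisorted_triples m] else [::].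

Lemma sorted_triplesE n : sorted_triples n =
  [seq (0, y, n - y) | y <- iota 0 n./2.+1] ++
  if 2 < n then [seq (s.1.1.+1, s.1.2.+1, s.2.+1) | s <- sorted_triples (n - 3)] else [::].
Proof. by case: n => [|[|[|n]]] //; rewrite [n.+3 - 3]subn0. Qed.

Lemma semisorted_triplesE n : semisorted_triples n =
  [seq (x, 0, n - x) | x <- iota 0 n.+1] ++
  if 1 < n then [seq (s.1.1, s.1.2.+1, s.2.+1) | s <- semisorted_triples (n - 2)] else [::].
Proof. by case: n => [|[|n]] //; rewrite [n.+2 - 2]subn0. Qed.

Lemma mem_sorted_triples n x y z :
  ((x, y, z) \in sorted_triples n) = (x <= y <= z) && (x + y + z == n).
Proof.
elim/ltn_ind: n x y z => n IH x y z.
have -> : ((x, y, z) \in sorted_triples n) =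
    ((x == 0) && (y <= n./2) && (z == n - y)) ||
    [&& 2 < n, 0 < x, 0 < y, 0 < z & (x.-1, y.-1, z.-1) \in sorted_triples (n - 3)].
  rewrite sorted_triplesE mem_cat; congr (_ || _).
    apply/mapP/idP => [[k]|/andP[/andP[/eqP-> yn] /eqP->]].
      by rewrite mem_iota => kn [-> -> ->]; rewrite !eqxx andbT /=; lia.
    by exists y => //; rewrite mem_iota.
  case: ifP => // _; apply/mapP/idP => [[[[x' y'] z'] mem [-> -> ->]] //|].
  by case: x y z => [|x] [|y] [|z] //= mem; exists (x, y, z).
case: (ltnP 2 n) => [n3|n3] /=; last lia.
by rewrite IH; lia.
Qed.

Lemma mem_semisorted_triples n x y z :
  ((x, y, z) \in semisorted_triples n) = (y <= z) && (x + y + z == n).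
Proof.
elim/ltn_ind: n x y z => n IH x y z.
have -> : ((x, y, z) \in semisorted_triples n) =
    ((x <= n) && (y == 0) && (z == n - x)) ||
    [&& 1 < n, 0 < y, 0 < z & (x, y.-1, z.-1) \in semisorted_triples (n - 2)].
  rewrite semisorted_triplesE mem_cat; congr (_ || _).
    apply/mapP/idP => [[k]|/andP[/andP[xn /eqP->] /eqP->]].
      by rewrite mem_iota => kn [-> -> ->]; rewrite !eqxx !andbT /=; lia.
    by exists x => //; rewrite mem_iota.
  case: ifP => // _; apply/mapP/idP => [[[[x' y'] z'] mem [-> -> ->]] //|].
  by case: y z => [|y] [|z] //= mem; exists (x, y, z).
case: (ltnP 1 n) => [n2|n2] /=; last lia.
by rewrite IH; lia.
Qed.

Lemma sorted_triples_uniq n : uniq (sorted_triples n).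
Proof.
elim/ltn_ind: n => n IH; rewrite sorted_triplesE cat_uniq; apply/and3P; split.
- by rewrite map_inj_uniq ?iota_uniq // => ? ? [].
- by case: ifP => // _; apply/hasPn => _ /mapP[s _ ->]; apply/mapP => -[].
case: ifP => // n3; rewrite map_inj_uniq ?IH //; first lia.
by case=> [[? ?] ?] [[? ?] ?] [-> -> ->].
Qed.

Lemma semisorted_triples_uniq n : uniq (semisorted_triples n).
Proof.
elim/ltn_ind: n => n IH; rewrite semisorted_triplesE cat_uniq;
  apply/and3P; split.
- by rewrite map_inj_uniq ?iota_uniq // => ? ? [].
- by case: ifP => // _; apply/hasPn => _ /mapP[s _ ->]; apply/mapP => -[].
case: ifP => // n2; rewrite map_inj_uniq ?IH //; first lia.
by case=> [[? ?] ?] [[? ?] ?] [-> -> ->].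
Qed.

(** [k] counts the shared atoms together with [dx + dy + dz], the atoms forced by positivity. The
    guard matters because [a - k] is truncated at 0. *)
Definition shift_triples (k dx dy dz a : nat) (f : nat -> seq (nat * nat * nat)) :=
  if k <= a then [seq (s.1.1 + dx, s.1.2 + dy, s.2 + dz) | s <- f (a - k)] else [::].

Definition triples_with (a : nat) (e : bool * bool * bool * bool) :=
  match e with
  | (false, false, false, false) => shift_triples 3 1 1 1 a sorted_triples
  | (false, false, false, true) => shift_triples 1 0 0 0 a sorted_triples
  | (true, true, true, false) => shift_triples 3 0 0 0 a sorted_triples
  | (false, false, true, false) => shift_triples 2 1 0 0 a semisorted_triples
  | (true, true, false, false) => shift_triples 2 0 0 0 a semisorted_triples
  | _ => [::]
  end.

Definition pair_patterns : seq (bool * bool * bool * bool) :=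
  [:: (false, false, false, false); (false, false, false, true);
      (true, true, true, false); (false, false, true, false);
      (true, true, false, false)].

Definition codes (a : nat) : seq code :=
  [seq (e, s) | e <- pair_patterns, s <- triples_with a e].

Lemma mem_shift_triples k dx dy dz a f x y z :
  ((x, y, z) \in shift_triples k dx dy dz a f) =
  [&& k <= a, dx <= x, dy <= y, dz <= z & (x - dx, y - dy, z - dz) \in f (a - k)].
Proof.
rewrite /shift_triples; case: leqP => //= _; apply/mapP/idP.
  by case=> [[[x' y'] z'] mem [-> -> ->]]; rewrite !leq_addl !addnK.
by case/and4P=> ? ? ? mem; exists (x - dx, y - dy, z - dz); rewrite //= !subnK.
Qed.

Lemma mem_codes a c : (c \in codes a) = canonical c && (atom_count c == a).
Proof.
apply/allpairsPdep/idP => [[e [[[x y] z] [_ + ->]]]|].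
  case: e => [[[[] []] []] []] //=; rewrite mem_shift_triples
    ?mem_sorted_triples ?mem_semisorted_triples; lia.
case: c => [e [[x y] z]] H; exists e, (x, y, z); split=> //.
  by move: H; case: e => [[[[] []] []] []].
move: H; case: e => [[[[] []] []] []] //=; rewrite mem_shift_triples
    ?mem_sorted_triples ?mem_semisorted_triples; lia.
Qed.

Lemma codes_uniq a : uniq (codes a).
Proof.
apply: allpairs_uniq_dep => //; last by move=> [e s] [e' s'] _ _ [-> ->].
move=> e _; have shift k dx dy dz f : uniq (f (a - k)) -> uniq (shift_triples k dx dy dz a f).
  rewrite /shift_triples; case: leqP => // _ uf; rewrite map_inj_uniq //.
  by case=> [[? ?] ?] [[? ?] ?] [/addIn-> /addIn-> /addIn->].
by case: e => [[[[] []] []] []] //=; apply: shift;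
  rewrite ?sorted_triples_uniq ?semisorted_triples_uniq.
Qed.

(** * Size of the enumeration *)

Lemma size_sorted_triples6 n : 6 <= n ->
  size (sorted_triples n) = size (sorted_triples (n - 6)) + n.
Proof.
move=> n6; rewrite (subnDA 3 n 3 : n - 6 = n - 3 - 3) sorted_triplesE (sorted_triplesE (n - 3)).
have -> : 2 < n by lia.
have -> : 2 < n - 3 by lia.
(* Two unfoldings contribute [n./2 + 1] and [(n - 3)./2 + 1]; exactly one of [n] and [n - 3] is odd,
   so the sum is [n]. *)
rewrite !(size_cat, size_map, size_iota); lia.
Qed.

Lemma size_semisorted_triples6 n : 6 <= n ->
  size (semisorted_triples n) = size (semisorted_triples (n - 6)) + (3 * n - 3).
Proof.
move=> n6; have -> : n - 6 = n - 2 - 2 - 2 by lia.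
rewrite semisorted_triplesE (semisorted_triplesE (n - 2)) (semisorted_triplesE (n - 2 - 2)).
have [-> -> ->] : [/\ 1 < n, 1 < n - 2 & 1 < n - 2 - 2] by split; lia.
(* Three unfoldings contribute [n + 1], [n - 1] and [n - 3]. *)
rewrite !(size_cat, size_map, size_iota); lia.
Qed.

Lemma size_codes a : 0 < a -> size (codes a) = (9 * a ^ 2 + 4 * a + 3) %/ 12.
Proof.
have size_shift b k dx dy dz f :
  size (shift_triples k dx dy dz b f) = if k <= b then size (f (b - k)) else 0.
  by rewrite /shift_triples; case: leqP => // _; rewrite size_map.
rewrite size_allpairs_dep /= !size_shift.
elim/ltn_ind: a => a IH a_gt0.
(* The step of 6 is applied to [a - 3], which requires [a] to be at least 9; smaller values are
   computed. *)
have [a_lt9|a_ge9] := ltnP a 9.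
  by move: a a_gt0 a_lt9 {IH}; do 9![case=> //].
have := IH (a - 6); rewrite !(subnAC a 6).
have [-> -> -> ->] : [/\ 2 < a, 1 < a, 2 < a - 6 & 1 < a - 6] by split; lia.
have [-> -> ->] : [/\ a - 6 < a, 0 < a - 6 & 0 < a] by split; lia.
move/(_ isT isT) => IH6.
rewrite (@size_sorted_triples6 (a - 3)) ?(@size_sorted_triples6 (a - 1))
  ?(@size_semisorted_triples6 (a - 2)); lia.
Qed.

(** * The number of lattices *)

Lemma R_eq_codes a : R_eq 3 a (size (codes a)).
Proof.
pose c i := tnth (in_tuple (codes a)) i.
have cP i : canonical (c i) /\ \sum_b code_profile (c i) b = a.
  by have := mem_tnth i (in_tuple (codes a));
    rewrite mem_codes sum_code_profile => /andP[? /eqP].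
have [F FP] := fin_all_exists (fun i => profile_exists (cP i).2).
have F_valid i : linear_space (F i) /\ covering (F i).
  apply/valid_profileP; have [can _] := cP i.
  by have := canonical_valid can; rewrite /valid_profile !FP.
have u012 : uniq [:: o0; o1; o2] by [].
apply: (@R_eq_incidence _ _ _ F) => //; try by move=> i; case: (F_valid i).
(* An isomorphism relates the two profiles by the rearrangement along [g], and [canonical_unique]
   identifies the codes. *)
- move=> i j [f [g [f_bij g_bij fg]]].
  have u_g : uniq [seq g k | k <- [:: o0; o1; o2]] by rewrite (map_inj_uniq (bij_inj g_bij)).
  have cij : c i = c j.
    apply: (canonical_unique u_g (cP i).1 (cP j).1) => b.
    by rewrite -!FP -(profile_iso _ _ _ f_bij fg) profile_rearrange.
  by apply: (tuple_uniqP (in_tuple (codes a)) (codes_uniq a)).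
move=> r r_lin r_cov.
have r_valid : valid_profile (profile r o0 o1 o2) by apply/valid_profileP.
have [p [q [s [u can]]]] := canonical_exists r_valid.
pose cr := code_in (profile r o0 o1 o2) p q s.
have crE : profile r p q s =1 code_profile cr.
  (* An injective rearrangement of a finite type is surjective, so every triple can be written as a
     rearranged one. *)
  move=> b; have [b' _ bK] := injF_bij (rearrange_inj u).
  by rewrite -(bK b) profile_rearrange // -code_inK.
have /tnthP[i ci] : cr \in in_tuple (codes a).
  by rewrite mem_codes can -sum_code_profile -(eq_bigr _ (fun b _ => crE b)) sum_profile /=.
by exists i; apply: (profile_eq_iso u u012) => b; rewrite crE FP /c -ci.
Qed.

Lemma floor_formula (a : nat) :
  (Num.floor (3 / 4 * a%:R ^+ 2 + 1 / 3 * a%:R + 1 / 4 : rat) =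
    ((9 * a ^ 2 + 4 * a + 3) %/ 12)%N%:Z :> int)%R.
Proof.
set m := (9 * a ^ 2 + 4 * a + 3)%N.
have -> : (3 / 4 * a%:R ^+ 2 + 1 / 3 * a%:R + 1 / 4 : rat)%R = (m%:R / 12)%R.
  by rewrite /m natrD natrD natrM natrX natrM; field.
(* Writing [m = 12 q + k] with [k < 12] places [m / 12] in the interval from [q] to [q + 1], right
   end excluded. *)
apply: floor_def; have := divn_eq m 12; have := ltn_pmod m (isT : 0 < 12)%N.
set q := (m %/ 12)%N; set k := (m %% 12)%N => k12 ->.
rewrite intrD -!pmulrn natrD natrM.
have k_ge0 : (0 <= k%:R :> rat)%R by apply: ler0n.
have k_lt12 : (k%:R < 12%:R :> rat)%R by rewrite ltr_nat.
by apply/andP; split; lra.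
Qed.

Theorem theorem4p2 (a : nat) (ha : (1 <= a)%N) (N : nat) :
  R_eq 3 a N <->
  (N%:Z = Num.floor (3 / 4 * a%:R ^+ 2 + 1 / 3 * a%:R + 1 / 4 : rat) :> int)%R.
Proof.
rewrite floor_formula -(size_codes ha); split=> [R_N|[->]];
  last exact: R_eq_codes.
by congr Posz; apply: R_eq_inj R_N (R_eq_codes a).
Qed.
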